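(* Let $T>0$, $p\in[2,\infty)$, $\sigma\in[1,2)$, and let $g\in W^{\sigma,p}(0,T)$ (an $\mathbb{R}^d$-valued function, taken as its continuous representative). Then there is a constant $C$ depending only on $p$ such that for every $N\in\mathbb{N}$, with $h=T/N$, $$\Big|\int_0^T g(t)\,dt-Q_h[g]\Big|\le C\,T^{1-\frac1p}\,h^{\sigma}\,\|g\|_{W^{\sigma,p}(0,T)}.$$
   Context: For $N\in\mathbb{N}$ let $h=T/N$ and $t_j=jh$, $j=0,\dots,N$. The classical trapezoidal quadrature is $Q_h[g]:=\frac h2\sum_{i=0}^{N-1}\big(g(t_i)+g(t_{i+1})\big)$. For $\sigma\in(1,2)$ and $p\in[2,\infty)$, $W^{\sigma,p}(0,T)$ is the fractional Sobolev space of $\mathbb{R}^d$-valued functions $g$ with weak derivative $\dot g$ and finite Sobolev–Slobodeckij norm $$\|g\|_{W^{\sigma,p}(0,T)}=\Big(\int_0^T|g(t)|^pdt+\int_0^T|\dot g(t)|^pdt+\int_0^T\!\!\int_0^T\frac{|\dot g(t)-\dot g(s)|^p}{|t-s|^{1+(\sigma-1)p}}\,dt\,ds\Big)^{1/p};$$ for $\sigma=1$, $W^{1,p}(0,T)$ is the usual Sobolev space with norm $\big(\int_0^T|g|^p+\int_0^T|\dot g|^p\big)^{1/p}$. *)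

(* Defs.v *)
From HB Require Import structures.
From mathcomp Require Import all_boot all_order all_algebra.
From mathcomp Require Import all_classical all_reals all_analysis.
Set Implicit Arguments. Unset Strict Implicit. Unset Printing Implicit Defensive.
Import Order.TTheory GRing.Theory Num.Theory.
Import numFieldNormedType.Exports.
Local Open Scope classical_set_scope.
Local Open Scope ring_scope.

Section Defs.
Variable R : realType.
Local Notation mu := (@lebesgue_measure R).

Definition open_itv0 (T : R) : set R := `]0, T[.

Definition enorm (d : nat) (v : 'rV[R]_d) : R :=
  Num.sqrt (\sum_(i < d) (v ord0 i) ^+ 2).

Definition vintegral (d : nat) (a b : R) (g : R -> 'rV[R]_d) : 'rV[R]_d :=
  \row_(i < d) Rintegral mu `[a, b] (fun t => g t ord0 i).

Definition trapezoid (d : nat) (T : R) (N : nat) (g : R -> 'rV[R]_d) : 'rV[R]_d :=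
  let h := T / N%:R in
  (h / 2) *: \sum_(i < N) (g (i%:R * h) + g (i.+1%:R * h)).

Definition test_function (T : R) (phi : R -> R) : Prop :=
  (forall (n : nat) (x : R), derivable (derive1n n phi) x 1) /\
  exists a b : R, [/\ 0 < a, a < b, b < T &
    forall x, x < a \/ b < x -> phi x = 0].

Definition weak_derivative (d : nat) (T : R) (g gd : R -> 'rV[R]_d) : Prop :=
  forall i : 'I_d,
    measurable_fun `]0, T[ (fun t => gd t ord0 i) /\
    mu.-integrable `]0, T[ (fun t => (gd t ord0 i)%:E) /\
    forall phi, test_function T phi ->
      Rintegral mu `]0, T[ (fun t => g t ord0 i * derive1 phi t) =
      - Rintegral mu `]0, T[ (fun t => gd t ord0 i * phi t).

Definition Lp_pow (d : nat) (T p : R) (f : R -> 'rV[R]_d) : \bar R :=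
  (\int[mu]_(t in (open_itv0 T)) ((enorm (f t)) `^ p)%:E)%E.

Definition slobodeckij_pow (d : nat) (T s p : R) (gd : R -> 'rV[R]_d) : \bar R :=
  (\int[mu]_(t in (open_itv0 T)) \int[mu]_(u in (open_itv0 T))
     ((enorm (gd t - gd u)) `^ p / `|t - u| `^ (1 + (s - 1) * p))%:E)%E.

Definition W_norm_pow (d : nat) (T s p : R) (g gd : R -> 'rV[R]_d) : \bar R :=
  if s == 1 then (Lp_pow T p g + Lp_pow T p gd)%E
  else (Lp_pow T p g + Lp_pow T p gd + slobodeckij_pow T s p gd)%E.

Definition in_W (d : nat) (T s p : R) (g gd : R -> 'rV[R]_d) : Prop :=
  (forall i : 'I_d, measurable_fun `]0, T[ (fun t => g t ord0 i)) /\
  weak_derivative T g gd /\ (W_norm_pow T s p g gd < +oo)%E.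

Definition W_norm (d : nat) (T s p : R) (g gd : R -> 'rV[R]_d) : R :=
  (fine (W_norm_pow T s p g gd)) `^ (p^-1).

End Defs.

(* Main.v *)
Require Import Defs.
From HB Require Import structures.
From mathcomp Require Import all_boot all_order all_algebra.
From mathcomp Require Import all_classical all_reals all_analysis.
From mathcomp Require Import measurable_realfun.
From mathcomp Require Import ring lra.
Import Order.TTheory GRing.Theory Num.Theory.
Import numFieldNormedType.Exports.
Local Open Scope classical_set_scope.
Local Open Scope ring_scope.

(** Testing the weak derivative against smooth steps that sharpen to the
    indicator of an interval gives [g b - g a] as the integral of the
    derivative. On a cell [[a, b]] of length [h] and midpoint [m], subtracting
    an affine function of slope [c] does not change the trapezoidal error, and
    twice the distance of [g t - c (t - m)] to the mean of the endpoint values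
    is a difference of integrals of [g' - c] over [[a, t]] and [[t, b]]; so the
    error is at most [h / 2] times the integral of [|g' - c|] over the cell.
    Take [c = 0] if [sigma = 1]; otherwise take [c = g' u] and average over [u]
    in the cell. Instead of Hoelder's inequality, the elementary bound
    [x <= e + e^(1-p) x^p] with [e = h^(sigma-1) T^(-1/p) W] gives the estimate
    with constant [1] for every [W] above the norm. The vector case follows by
    pairing [g] with the unit vector in the direction of the error, so that no
    dimension enters the constant. *)

(** * A smooth step function *)

Section TimesDerivable.
Context {R : realType}.
Implicit Types (f g : R -> R) (n : nat).

(* The existential form makes closure properties provable without computing
   [derive1]. *)
Fixpoint times_derivable n f : Prop :=
  if n is m.+1 then
    exists2 f', (forall x, is_derive x (1 : R) f (f' x)) & times_derivable m f'
  else True.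

Lemma times_derivableW n f : times_derivable n.+1 f -> times_derivable n f.
Proof.
elim: n f => [//|n IH] f [f' ff' f'n]; exists f' => //; exact: IH.
Qed.

Lemma is_derive_derive1 {f f' : R -> R} :
  (forall x, is_derive x (1 : R) f (f' x)) -> derive1 f = f'.
Proof.
by move=> ff'; apply/funext => x; rewrite derive1E; have [_ ->] := ff' x.
Qed.

(** Passes to the iterated [derive1n] in which [test_function] states smoothness; the induction
    strips the innermost derivative first. *)
Lemma times_derivableP f : (forall n, times_derivable n f) ->
  forall n x, derivable (derive1n n f) x 1.
Proof.
move=> fn n; have := fn n.+1; elim: n f {fn} => [|n IH] f.
  by case=> f' ff' _ x; have [] := ff' x.
by case=> f' ff' f'n x; rewrite derive1Sn (is_derive_derive1 ff'); exact: IH.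
Qed.

Lemma times_derivable_cst n (c : R) : times_derivable n (cst c).
Proof.
elim: n c => [//|n IH] c; exists (cst 0) => // x; exact: is_derive_cst.
Qed.

Lemma times_derivableD n f g : times_derivable n f -> times_derivable n g ->
  times_derivable n (f \+ g).
Proof.
elim: n f g => [//|n IH] f g [f' ff' f'n] [g' gg' g'n].
by exists (f' \+ g'); [move=> x; exact: is_deriveD|exact: IH].
Qed.

Lemma times_derivableM n f g : times_derivable n f -> times_derivable n g ->
  times_derivable n (f \* g).
Proof.
elim: n f g => [//|n IH] f g fn gn.
move: (fn) (gn) => [f' ff' f'n] [g' gg' g'n].
exists ((f \* g') \+ (g \* f')) => [x|]; first exact: is_deriveM.
by apply: times_derivableD; apply: IH => //; exact: times_derivableW.
Qed.

Lemma times_derivableZ n (k : R) f : times_derivable n f ->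
  times_derivable n (k \*: f).
Proof.
by move=> fn; apply: (@times_derivableM n (cst k)) => //;
  exact: times_derivable_cst.
Qed.

Lemma is_derive_affine (a b x : R) :
  is_derive x (1 : R) (fun y => a * y + b) a.
Proof.
apply: (@is_derive_eq _ _ _ ((a \*: id) \+ cst b)).
by rewrite addr0; exact: mulr1.
Qed.

Lemma times_derivable_affine n f (a b : R) : times_derivable n f ->
  times_derivable n (fun x => f (a * x + b)).
Proof.
elim: n f => [//|n IH] f [f' ff' f'n].
exists (a \*: (fun x => f' (a * x + b))); last exact/times_derivableZ/IH.
move=> x; rewrite /= -[_ *: _]/(a * _) mulrC.
have := is_derive_affine a b x.
exact: is_derive1_comp.
Qed.

(** The derivative [- f' / f ^+ 2] involves [f^-1] only to one order less, so induction on [n] with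
    [f] fixed suffices. *)
Lemma times_derivableV n f : (forall x, f x != 0) -> times_derivable n f ->
  times_derivable n (fun x => (f x)^-1).
Proof.
move=> f0; elim: n => [//|n IH] fn.
have fV := IH (times_derivableW _ _ fn).
case: fn => f' ff' f'n.
exists (((-1) \*: ((fun x => (f x)^-1) \* (fun x => (f x)^-1))) \* f').
  move=> x; apply: (is_derive_eq (is_deriveV (f0 x) (ff' x))).
  by rewrite /= !scaleN1r !mulNr scaleNr expr2 invfM.
by apply: times_derivableM => //; exact/times_derivableZ/times_derivableM.
Qed.

End TimesDerivable.

Section SmoothStep.
Context {R : realType}.

(** For [k = 0] this is the classical smooth non-analytic function; the powers of [x^-1] make the
    family closed under differentiation up to linear combinations. *)
Definition flat (k : nat) (x : R) : R :=
  if 0 < x then x^-1 ^+ k * expR (- x^-1) else 0.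

Lemma flat_ge0 k x : 0 <= flat k x.
Proof.
by rewrite /flat; case: ifPn => // x0; rewrite mulr_ge0 ?expR_ge0 ?exprn_ge0 ?invr_ge0 ?ltW.
Qed.

Lemma flat_gt0 x : 0 < x -> 0 < flat 0 x.
Proof. by move=> x0; rewrite /flat x0 expr0 mul1r expR_gt0. Qed.

Lemma flat_le0 k x : x <= 0 -> flat k x = 0.
Proof. by rewrite /flat leNgt => /negbTE ->. Qed.

(** The exponential of [x^-1] dominates the term of order [k.+1] of its series, which leaves one
    factor [x] to spare. *)
Lemma flat_le_linear k x : flat k x <= (k.+1)`!%:R * `|x|.
Proof.
have [x0|x0] := leP x 0; first by rewrite flat_le0// mulr_ge0.
have y0 : 0 < x^-1 by rewrite invr_gt0.
rewrite /flat x0 gtr0_norm// expRN.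
rewrite ler_pdivrMr ?expR_gt0//.
have yk := expR_ge1Dxn k (ltW y0).
have kf : 0 < (k.+1)`!%:R :> R by rewrite ltr0n fact_gt0.
have h : x^-1 ^+ k.+1 <= (k.+1)`!%:R * expR x^-1.
  rewrite mulrC -ler_pdivrMr//; apply: le_trans yk; rewrite lerDr//.
have -> : x^-1 ^+ k = x * x^-1 ^+ k.+1.
  by rewrite exprS mulrA divff ?gt_eqF// mul1r.
by rewrite [_ * x]mulrC -mulrA ler_pM2l.
Qed.

Lemma is_derive_flat k x :
  is_derive x (1 : R) (flat k) (flat k.+2 x - k%:R * flat k.+1 x).
Proof.
have [x0|x0|->] := ltgtP x 0.
- rewrite !flat_le0 ?ltW// mulr0 subr0.
  apply: (@near_eq_is_derive _ R R (cst 0)).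
    by near=> y; rewrite flat_le0// ltW//; near: y; exact: lt_nbhsl.
- have xN0 : x != 0 by rewrite gt_eqF.
  apply: (@near_eq_is_derive _ R R (fun y : R => y^-1 ^+ k * expR (- y^-1))).
    near=> y; rewrite /flat ifT//; near: y; exact: lt_nbhsr.
  have dV : is_derive x (1 : R) (fun y : R => y^-1) (- x^-1 ^+ 2).
    apply: (is_derive_eq (is_deriveV (f := id) xN0 (is_derive_id _ _))).
    by rewrite [_ *: _]mulr1 exprVn.
  have dE : is_derive x (1 : R) (fun y : R => expR (- y^-1)) (expR (- x^-1) * x^-1 ^+ 2).
    apply: (@is_derive1_comp _ expR (fun y => - y^-1)).
    by rewrite -[X in is_derive _ _ _ X]opprK; exact: is_deriveN.
  have dX : is_derive x (1 : R) (fun y : R => y^-1 ^+ k) (k%:R * x^-1 ^+ k.-1 * - x^-1 ^+ 2).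
    have := is_deriveX k dV; rewrite exprfctE; exact.
  apply: (is_derive_eq (is_deriveM dX dE)).
  transitivity (x^-1 ^+ k * (expR (- x^-1) * x^-1 ^+ 2) +
    expR (- x^-1) * (k%:R * x^-1 ^+ k.-1 * - x^-1 ^+ 2)); first by [].
  by rewrite /flat x0; case: k dX => [|k] _ /=; rewrite !exprS ?expr0; ring.
- rewrite !flat_le0// mulr0 subr0.
  have h0 : (fun h : R => h^-1 *: (flat k (h + 0) - flat k 0)) @ 0^' --> (0 : R).
    apply/cvgrPdist_le => /= e e0.
    have C0 : 0 < (k.+2)`!%:R :> R by rewrite ltr0n fact_gt0.
    near=> h.
    have hN0 : h != 0 by near: h; exact: nbhs_dnbhs_neq.
    rewrite addr0 (flat_le0 _ _ (lexx _)) subr0 sub0r normrN.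
    (* The difference quotient at the origin only raises the index, so the linear bound sends it to
       zero. *)
    have -> : h^-1 *: flat k h = flat k.+1 h.
      rewrite /flat; case: ifP => _; last by rewrite scaler0.
      by rewrite [_ *: _]mulrA -exprS.
    rewrite ger0_norm ?flat_ge0//; apply: (le_trans (flat_le_linear _ _)).
    rewrite mulrC -ler_pdivlMr//; near: h.
    by apply: dnbhs0_le; rewrite divr_gt0.
  split.
    by apply/cvg_ex; exists 0; move: h0; under eq_fun do rewrite -[X in X + 0]mulr1.
  by rewrite -derive1E; exact/cvg_lim.
Unshelve. all: by end_near. Qed.

Lemma times_derivable_flat n k : times_derivable n (flat k).
Proof.
elim: n k => [//|n IH] k.
exists (flat k.+2 \+ ((- k%:R) \*: flat k.+1)).
  by move=> x; rewrite /= scaleNr; exact: is_derive_flat.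
by apply: times_derivableD => //; exact: times_derivableZ.
Qed.

(** The quotient of [flat 0 x] by [flat 0 x + flat 0 (1 - x)] works: [x] and [1 - x] are never both
    nonpositive, so the denominator is positive. *)
Lemma smooth_step : exists2 f : R -> R, forall n, times_derivable n f &
  [/\ forall x, 0 <= f x <= 1, forall x, x <= 0 -> f x = 0 &
      forall x, 1 <= x -> f x = 1].
Proof.
pose s (x : R) := flat 0 x + flat 0 ((-1) * x + 1).
have s0 x : 0 < s x.
  rewrite /s; have [x0|x0] := ltP 0 x.
    by rewrite ltr_pwDl ?flat_gt0 ?flat_ge0.
  by rewrite ltr_wpDl ?flat_ge0// flat_gt0//; lra.
exists (flat 0 \* (fun x => (s x)^-1)) => [n|].
  apply: times_derivableM; first exact: times_derivable_flat.
  apply: times_derivableV => [x|]; first by rewrite gt_eqF.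
  apply: times_derivableD; first exact: times_derivable_flat.
  exact/times_derivable_affine/times_derivable_flat.
split=> x /=.
- apply/andP; split; first by rewrite divr_ge0 ?flat_ge0// ltW.
  by rewrite ler_pdivrMr// mul1r lerDl flat_ge0.
- by move=> x0; rewrite flat_le0// mul0r.
- move=> x1; rewrite /s (flat_le0 _ ((-1) * x + 1)); last lra.
  by rewrite addr0 divff// gt_eqF// flat_gt0//; lra.
Qed.

End SmoothStep.

(** * Increments as integrals of the weak derivative *)

Section WeakFTC.
Context {R : realType}.
Local Notation mu := (@lebesgue_measure R).

Lemma smooth_step_deriv : exists (s s' : R -> R) (M : R),
  [/\ forall n, times_derivable n s,
      forall x, 0 <= s x <= 1,
      forall x, x <= 0 -> s x = 0 &
      forall x, 1 <= x -> s x = 1] /\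
  [/\ forall x, is_derive x (1 : R) s (s' x), continuous s',
      forall x, `|s' x| <= M & forall x, x < 0 \/ 1 < x -> s' x = 0].
Proof.
have [s ns [s01 s0 s1]] := @smooth_step R.
(* Order two is enough here: the existence of [s''] makes [s'] continuous. *)
have [s' ss' [s'' s's'' _]] := ns 2.
have cs' : continuous s'.
  by move=> x; apply/differentiable_continuous/derivable1_diffP; have [] := s's'' x.
have s'0 x : x < 0 \/ 1 < x -> s' x = 0.
  move=> x01; have [_ <-] := ss' x.
  case: x01 => [x0|x1].
    rewrite (@near_eq_derive _ R R s (cst 0)) ?derive_cst//.
    by near=> y; rewrite s0// ltW//; near: y; exact: lt_nbhsl.
  rewrite (@near_eq_derive _ R R s (cst 1)) ?derive_cst//.
  by near=> y; rewrite s1// ltW//; near: y; exact: lt_nbhsr.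
(* Since [s'] vanishes off [[0, 1]], its maximum modulus there bounds it everywhere. *)
have [c c01 cmax] := @EVT_max R (fun x => `|s' x|) 0 1 ler01
  (continuous_subspaceT (fun x => cvg_norm (cs' x))).
exists s, s', `|s' c|; split=> //; split=> // x.
have [x0|x0] := ltP x 0; first by rewrite s'0 ?normr0//; left.
have [x1|x1] := ltP 1 x; first by rewrite s'0 ?normr0//; right.
by apply: cmax; rewrite in_itv/= x0.
Unshelve. all: by end_near. Qed.

(** The argument is [(y - c) / e], kept in the form [a * y + b] of the affine lemmas. *)
Lemma is_derive_rescale (s s' : R -> R) (c e x : R) :
  (forall x, is_derive x (1 : R) s (s' x)) ->
  is_derive x (1 : R) (fun y => s (e^-1 * y + - (c / e))) (s' (e^-1 * x + - (c / e)) / e).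
Proof.
by move=> ss'; have := is_derive_affine e^-1 (- (c / e)) x; exact: is_derive1_comp.
Qed.

Lemma continuous_rescale (f : R -> R) (a b : R) :
  continuous f -> continuous (fun y => f (a * y + b)).
Proof.
move=> cf x; apply: continuous_comp; last exact: cf.
by apply: cvgD; [apply: cvgM; [exact: cvg_cst|exact: cvg_id]|exact: cvg_cst].
Qed.

Lemma continuous_itv_integrable (f : R -> R) (a b : R) :
  {within `[a, b], continuous f} -> mu.-integrable `[a, b] (EFin \o f).
Proof. by apply: continuous_compact_integrable; exact: segment_compact. Qed.

Lemma integrable_patch (A : set R) (f : R -> R) : measurable A ->
  mu.-integrable A (EFin \o f) -> mu.-integrable setT (EFin \o (f \_ A)).
Proof.
move=> mA fi; rewrite -restrict_EFin.
by apply/integrable_restrict => //=; rewrite setTI.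
Qed.

Lemma Rintegral_itv_cst (a b k : R) : a <= b ->
  \int[mu]_(x in `[a, b]) k = k * (b - a).
Proof.
move=> ab; rewrite Rintegral_cst//= lebesgue_measure_itv/= lte_fin.
by case: ltgtP ab => [| |-> _]//=; rewrite subrr.
Qed.

(** The derivative of the rescaled step is a one-sided approximate identity at [c]: it lives on
    [[c, c + e]], has integral one and is bounded by [M / e]. Continuity of [g] at [c] does the
    rest. *)
Lemma mollify_cvg (e_ : R^nat) (s s' : R -> R) (M T c : R) (g : R -> R) :
  (forall n, 0 < e_ n) -> e_ @ \oo --> (0 : R) ->
  (forall x, x <= 0 -> s x = 0) -> (forall x, 1 <= x -> s x = 1) ->
  (forall x, is_derive x (1 : R) s (s' x)) -> continuous s' ->
  (forall x, `|s' x| <= M) -> (forall x, x < 0 \/ 1 < x -> s' x = 0) ->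
  0 < c < T -> {within `[0, T], continuous g} ->
  \int[mu]_(x in `]0, T[)
     (g x * (s' ((e_ n)^-1 * x + - (c / e_ n)) / e_ n))
    @[n --> \oo] --> g c.
Proof.
move=> e_gt0 e_cvg s0 s1 ss' cs' s'M s'0 /andP[c0 cT] cg.
have M0 : 0 <= M by apply: le_trans (s'M 0).
have gc : {for c, continuous g}.
  have T0 : 0 < T by lra.
  by have /(continuous_within_itvP _ T0)[+ _ _] := cg; apply; rewrite in_itv/= c0.
apply/cvgrPdist_le => eps eps0.
(* The summand [1] keeps the denominator positive when [M = 0]. *)
pose eta := eps / (M + 1).
have eta0 : 0 < eta by rewrite divr_gt0// ltr_wpDl.
move/cvgrPdist_le : gc => /(_ _ eta0) /nbhs_ballP[d /= d0 gd].
near=> n.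
have e0 : 0 < e_ n :> R by [].
have ed : e_ n < d :> R.
  by near: n; move: e_cvg => /cvgr_lt; exact.
have eT : e_ n < T - c :> R.
  near: n; move: e_cvg => /cvgr_lt; apply; lra.
move: (e_ n) e0 ed eT => e e0 ed eT.
pose k x : R := s' (e^-1 * x + - (c / e)) / e.
have argE x : e^-1 * x + - (c / e) = (x - c) / e by rewrite mulrBl mulrC.
have ck : continuous k.
  move=> x; apply: cvgM; last exact: cvg_cst.
  exact: (continuous_rescale _ _ _ cs').
have kI x : ~ (`[c, c + e]%classic x) -> k x = 0.
  rewrite /k /= in_itv/= argE => /negP; rewrite negb_and -!ltNge => xI.
  rewrite s'0 ?mul0r//; case/orP : xI => xI; [left|right].
    by rewrite pmulr_llt0 ?invr_gt0//; lra.
  by rewrite ltr_pdivlMr//; lra.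
have cgI : {within `[c, c + e], continuous g}.
  by apply: continuous_subspaceW cg => x /=; rewrite !in_itv/= => /andP[? ?];
    apply/andP; split; lra.
have ckI : {within `[c, c + e], continuous k} by exact: continuous_subspaceT.
have -> : \int[mu]_(x in `]0, T[) (g x * k x) = \int[mu]_(x in `[c, c + e]) (g x * k x).
  transitivity (\int[mu]_(x in `]0, T[) ((fun x => g x * k x) \_ `[c, c + e]) x).
    apply: eq_Rintegral => x _; rewrite patchE; case: ifPn => // xI.
    by rewrite kI ?mulr0// => ?; move/negP: xI; apply; rewrite inE.
  rewrite -Rintegral_mkcondr; congr Rintegral; apply/seteqP; split => x /=.
    by case.
  by rewrite !in_itv/= => /andP[? ?]; split; apply/andP; split; lra.
have k1 : \int[mu]_(x in `[c, c + e]) k x = 1.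
  rewrite /Rintegral (@continuous_FTC2 _ _ (fun x => s (e^-1 * x + - (c / e)))) //=.
  - rewrite !argE s1 ?s0 ?subr0//; first by rewrite subrr mul0r.
    by rewrite (addrC c) addrK divff// gt_eqF.
  - lra.
  - have cS : continuous (fun x => s (e^-1 * x + - (c / e))).
      apply: continuous_rescale => x; apply/differentiable_continuous/derivable1_diffP.
      by have [] := ss' x.
    split; [|exact/cvg_at_right_filter/cS|exact/cvg_at_left_filter/cS].
    by move=> x _; have [] := is_derive_rescale _ _ c e x ss'.
  - by move=> x _; rewrite derive1E; have [_ ->] := is_derive_rescale _ _ c e x ss'.
have ik : mu.-integrable `[c, c + e] (EFin \o k) by exact: continuous_itv_integrable.
have igk : mu.-integrable `[c, c + e] (EFin \o (fun x => g x * k x)).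
  by apply: continuous_itv_integrable => x; apply: continuousM; [exact: cgI|exact: ckI].
have igck : mu.-integrable `[c, c + e] (EFin \o (fun x => g c * k x)).
  apply: continuous_itv_integrable => x; apply: continuousM; last exact: ckI.
  exact: cvg_cst.
(* As the kernel has mass one, [g c] becomes the integral of [g c * k x], and the difference is a
   single integral. *)
rewrite -[X in X - _]mulr1 -k1 -RintegralZl// -RintegralB//.
have iB : mu.-integrable `[c, c + e] (EFin \o (fun x => g c * k x - g x * k x)).
  by have := integrableB _ igck igk; exact.
apply: le_trans (le_normr_Rintegral _ iB) _ => //.
have -> : eps = (eta * (M + 1)) by rewrite /eta divfK// gt_eqF// ltr_wpDl.
apply: (@le_trans _ _ (\int[mu]_(x in `[c, c + e]) (eta * M / e))); last first.
  rewrite Rintegral_itv_cst; last lra.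
  rewrite (addrC c) addrK divfK ?gt_eqF// ler_pM2l//; lra.
apply: le_Rintegral => //.
- by have := integrable_norm iB; exact.
- by apply: continuous_itv_integrable => x; exact: cvg_cst.
- move=> x; rewrite /= in_itv/= => /andP[cx xce].
  rewrite -mulrBl normrM -mulrA ler_pM//.
    by apply: gd; rewrite /ball/= ltr_norml; apply/andP; split; lra.
  have eV : `|e^-1| = e^-1 by rewrite ger0_norm// invr_ge0 ltW.
  by rewrite /k normrM eV ler_pM2r ?invr_gt0.
Unshelve. all: by end_near. Qed.

(** Dominated convergence with majorant the modulus of [f]. The steps tend pointwise to the
    indicator of []c, +oo[], which omits [c] because [s 0 = 0]. *)
Lemma cutoff_cvg (e_ : R^nat) (s : R -> R) (T c : R) (f : R -> R) :
  (forall n, 0 < e_ n) -> e_ @ \oo --> (0 : R) ->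
  continuous s -> (forall x, 0 <= s x <= 1) ->
  (forall x, x <= 0 -> s x = 0) -> (forall x, 1 <= x -> s x = 1) ->
  mu.-integrable `]0, T[ (EFin \o f) ->
  \int[mu]_(x in `]0, T[)
     (f x * s ((e_ n)^-1 * x + - (c / e_ n)))
    @[n --> \oo] --> \int[mu]_(x in `]c, +oo[) (f \_ `]0, T[) x.
Proof.
move=> e_gt0 e_cvg cs s01 s0 s1 fi.
(* The two truncations commute, so the limit becomes an integral over []0, T[], the domain of the
   sequence. *)
rewrite -Rintegral_mkcondr setIC Rintegral_mkcondr.
have mf : measurable_fun `]0, T[ f by apply/measurable_EFinP; exact: (measurable_int mu).
have mn n : measurable_fun `]0, T[
    (EFin \o (fun x => f x * s ((e_ n)^-1 * x + - (c / e_ n)))).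
  apply/measurable_EFinP/measurable_funM => //.
  apply: measurable_funTS; apply: continuous_measurable_fun.
  exact: continuous_rescale.
have ml : measurable_fun `]0, T[ (EFin \o (f \_ `]c, +oo[)).
  apply/measurable_EFinP.
  apply/(measurable_restrict _ _ _) => //.
  by apply: measurable_funS mf => // x [].
have [] := @dominated_convergence _ _ _ mu `]0, T[ (measurable_itv _) _
  (EFin \o (f \_ `]c, +oo[)) (abse \o (EFin \o f)) mn ml.
- apply: aeW => x /= _; apply/fine_cvgP; split; first exact: nearW.
  rewrite patchE; case: ifPn => [|]; rewrite ?notin_setE ?inE/= in_itv/= andbT.
    move=> cx; apply: cvg_near_cst; near=> n.
    have e0 : 0 < e_ n :> R by [].
    rewrite /= s1 ?mulr1// mulrC -mulrBl ler_pdivlMr// mul1r ltW//.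
    near: n; move: e_cvg => /cvgr_lt; apply; lra.
  move=> /negP; rewrite -leNgt => xc; apply: cvg_near_cst; near=> n.
  have e0 : 0 < e_ n :> R by [].
  rewrite /= s0 ?mulr0// mulrC -mulrBl pmulr_lle0 ?invr_gt0//; lra.
- exact: integrable_abse.
- apply: aeW => x n _ /=; rewrite lee_fin normrM.
  rewrite -[leRHS]mulr1 ler_wpM2l// ger0_norm; by case/andP: (s01 ((e_ n)^-1 * x + - (c / e_ n))).
move=> li _; rewrite /Rintegral => h; apply: fine_cvg.
by rewrite fineK//; exact: integrable_fin_num.
Unshelve. all: by end_near. Qed.

(** The test functions [S a n - S b n] tend to the indicator of []a, b]]. One side of the weak
    identity is then a difference of mollified values of [g], the other a truncated integral of
    [gd]. *)
Lemma weak_derivative_increment_oo (T : R) (g gd : R -> R) :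
  {within `[0, T], continuous g} -> mu.-integrable `]0, T[ (EFin \o gd) ->
  (forall phi, test_function T phi ->
     \int[mu]_(t in `]0, T[) (g t * derive1 phi t) =
     - \int[mu]_(t in `]0, T[) (gd t * phi t)) ->
  forall a b, 0 < a -> a < b -> b < T ->
    g b - g a = \int[mu]_(t in `]a, b]) (gd \_ `]0, T[) t.
Proof.
move=> cg igd weak a b a0 ab bT.
have [e_ e_gt0 e_cvg] : exists2 e_ : R^nat, forall n, 0 < e_ n & e_ @ \oo --> (0 : R).
  by exists harmonic; [move=> n; exact: harmonic_gt0|exact: cvg_harmonic].
have [s [s' [M [[ns s01 s0 s1] [ss' cs' s'M s'0]]]]] := smooth_step_deriv.
have cs : continuous s.
  by move=> x; apply/differentiable_continuous/derivable1_diffP; have [] := ss' x.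
pose S c n x : R := s ((e_ n)^-1 * x + - (c / e_ n)).
pose S' c n x : R := s' ((e_ n)^-1 * x + - (c / e_ n)) / e_ n.
have dS c n x : is_derive x (1 : R) (S c n) (S' c n x).
  exact: is_derive_rescale.
have cvgA : \int[mu]_(x in `]0, T[) (g x * S' a n x) -
            \int[mu]_(x in `]0, T[) (g x * S' b n x) @[n --> \oo] --> g a - g b.
  by apply: cvgB; apply: (mollify_cvg _ _ _ _ _ _ _ e_gt0 e_cvg s0 s1 ss' cs' s'M s'0) => //;
    apply/andP; split; lra.
have cvgB : - (\int[mu]_(x in `]0, T[) (gd x * S a n x) -
            \int[mu]_(x in `]0, T[) (gd x * S b n x)) @[n --> \oo] -->
   - (\int[mu]_(x in `]a, +oo[) (gd \_ `]0, T[) x -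
      \int[mu]_(x in `]b, +oo[) (gd \_ `]0, T[) x).
  by apply: cvgN; apply: cvgB; exact: (cutoff_cvg _ _ _ _ _ e_gt0 e_cvg).
have iphi : mu.-integrable setT (EFin \o (gd \_ `]0, T[)).
  exact: integrable_patch.
have -> : \int[mu]_(t in `]a, b]) (gd \_ `]0, T[) t =
   \int[mu]_(x in `]a, +oo[) (gd \_ `]0, T[) x -
      \int[mu]_(x in `]b, +oo[) (gd \_ `]0, T[) x.
  rewrite -(@Rintegral_itvB _ _ (BRight a) +oo%O b)//.
  - by rewrite subKr.
  - by apply: integrableS iphi.
  - by rewrite bnd_simp ltW.
apply: oppr_inj; rewrite opprB.
apply: cvg_unique cvgA _ => //.
(* The two sequences agree only once [e_ n < T - b], when the support fits inside []0, T[]. *)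
apply: cvg_trans cvgB; apply: near_eq_cvg; near=> n.
have e0 : 0 < e_ n :> R by [].
have eT : e_ n < T - b :> R.
  near: n; move: e_cvg => /cvgr_lt; apply; lra.
have cS c : continuous (S c n) by exact: continuous_rescale.
have cS' c : continuous (S' c n).
  move=> x; apply: cvgM; last exact: cvg_cst.
  exact: (continuous_rescale _ _ _ cs').
have igS' c : mu.-integrable `]0, T[ (EFin \o (fun x => g x * S' c n x)).
  apply: (@integrableS _ _ _ mu `[0, T]) => //; first exact: subset_itv_oo_cc.
  apply: continuous_itv_integrable => x; apply: continuousM; first exact: cg.
  exact: (continuous_subspaceT (cS' c)).
have igS c : mu.-integrable `]0, T[ (EFin \o (fun x => gd x * S c n x)).
  apply: (le_integrable _ _ _ igd) => //.
    apply/measurable_EFinP/measurable_funM.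
      by apply/measurable_EFinP; exact: (measurable_int mu).
    by apply: measurable_funTS; exact: continuous_measurable_fun.
  move=> x _ /=; rewrite lee_fin normrM.
  rewrite -[leRHS]mulr1 ler_wpM2l// ger0_norm;
  by case/andP: (s01 ((e_ n)^-1 * x + - (c / e_ n))).
rewrite -RintegralB// -RintegralB//.
have -> : \int[mu]_(x in `]0, T[) (gd x * S a n x - gd x * S b n x) =
  \int[mu]_(x in `]0, T[) (gd x * (S a n \- S b n) x).
  by apply: eq_Rintegral => x _; rewrite /= mulrBr.
rewrite -weak.
  apply: eq_Rintegral => x _; rewrite -mulrBr derive1E.
  by have [_ ->] := is_deriveB (dS a n x) (dS b n x).
split.
  apply: times_derivableP => m.
  have nS c : times_derivable m (S c n) by exact: times_derivable_affine.
  suff -> : S a n \- S b n = S a n \+ ((-1) \*: S b n).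
    by apply: times_derivableD => //; exact: times_derivableZ.
  by apply/funext => x /=; rewrite scaleN1r.
have argE c x : (e_ n)^-1 * x + - (c / e_ n) = (x - c) / e_ n.
  by rewrite mulrBl mulrC.
(* Left of [a] both steps are [0]; right of [b + e_ n] both are [1] and cancel. *)
exists a, (b + e_ n); split=> //; [lra|lra|].
move=> x [xa|xb]; rewrite /= /S !argE.
  rewrite !s0 ?subrr// pmulr_lle0 ?invr_gt0//; lra.
rewrite !s1 ?subrr// ler_pdivlMr//; lra.
Unshelve. all: by end_near. Qed.

(** The difference [w] of [g] and the primitive [P] of its derivative is constant on []0, T[] by the
    open case, and continuity carries this to the endpoints. *)
Lemma weak_derivative_increment (T : R) (g gd : R -> R) :
  0 < T -> {within `[0, T], continuous g} ->
  mu.-integrable `]0, T[ (EFin \o gd) ->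
  (forall phi, test_function T phi ->
     \int[mu]_(t in `]0, T[) (g t * derive1 phi t) =
     - \int[mu]_(t in `]0, T[) (gd t * phi t)) ->
  forall a b, 0 <= a -> a <= b -> b <= T ->
    g b - g a = \int[mu]_(t in `[a, b]) (gd \_ `]0, T[) t.
Proof.
move=> T0 cg igd weak.
set phi := gd \_ `]0, T[.
have iphi : mu.-integrable setT (EFin \o phi).
  exact: integrable_patch.
have iphiS (A : set R) : measurable A -> mu.-integrable A (EFin \o phi).
  by move=> mA; exact: integrableS iphi.
pose P x := \int[mu]_(t in `[0, x]) phi t.
have PB a b : 0 <= a -> a <= b -> P b - P a = \int[mu]_(t in `]a, b]) phi t.
  move=> a0 ab; rewrite /P Rintegral_itvB//; exact: iphiS.
pose w x := g x - P x.
have cw : {within `[0, T], continuous w}.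
  have cP := parameterized_integral_continuous (ltW T0) (iphiS `[0, T]%classic (measurable_itv _)).
  by move=> x; apply: cvgB; [exact: cg|exact: cP].
have wE x : 0 < x -> x < T -> w x = w (T / 2).
  have H a b : 0 < a -> a < b -> b < T -> w a = w b.
    move=> a0 ab bT; have := weak_derivative_increment_oo _ _ _ cg igd weak a b a0 ab bT.
    rewrite -/phi -PB ?ltW// /w; lra.
  move=> x0 xT; have [xT2|xT2|->//] := ltgtP x (T / 2).
    by apply: H => //; lra.
  by apply/esym; apply: H => //; lra.
have wE' x : 0 <= x -> x <= T -> w x = w (T / 2).
  have /(continuous_within_itvP _ T0)[_ w0 wT] := cw.
  rewrite le_eqVlt => /predU1P[<- _|x0].
    apply: cvg_unique w0 _ => //; apply: cvg_near_cst; near=> y.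
    by apply: wE; near: y; [exact: nbhs_right_gt|exact: nbhs_right_lt].
  rewrite le_eqVlt => /predU1P[->|xT]; last exact: wE.
  apply: cvg_unique wT _ => //; apply: cvg_near_cst; near=> y.
  by apply: wE; near: y; [exact: nbhs_left_gt|exact: nbhs_left_lt].
move=> a b a0 ab bT; rewrite -Rintegral_itv_obnd_cbnd; last exact: iphiS.
rewrite -PB//.
have := wE' a a0 (le_trans ab bT); rewrite -(wE' b (le_trans a0 ab) bT) /w; lra.
Unshelve. all: by end_near. Qed.

End WeakFTC.

(** * Local error of the trapezoidal rule *)

Section LocalError.
Context {R : realType}.
Local Notation mu := (@lebesgue_measure R).

(* Unlike [ge0_le_integral], this needs no measurability of the norms [enorm]
   that serve as majorants. *)
Lemma ge0_le_integral_nonmeasurable d (X : measurableType d)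
    (m : {measure set X -> \bar R}) (D : set X) (f g : X -> \bar R) :
  (forall x, D x -> 0 <= f x)%E -> (forall x, D x -> f x <= g x)%E ->
  (\int[m]_(x in D) f x <= \int[m]_(x in D) g x)%E.
Proof.
move=> f0 fg; have g0 x : D x -> (0 <= g x)%E.
  by move=> Dx; exact: le_trans (f0 _ Dx) (fg _ Dx).
rewrite !ge0_integralE//; apply: le_ereal_sup => _ /= [h hf <-].
exists h => // x; apply: le_trans (hf x) _.
by rewrite !patchE; case: ifPn => // /set_mem; exact: fg.
Qed.

Lemma Rintegral_itv_split (f : R -> R) (a b t : R) :
  mu.-integrable `[a, b] (EFin \o f) -> a <= t -> t <= b ->
  \int[mu]_(x in `[a, b]) f x =
  \int[mu]_(x in `[a, t]) f x + \int[mu]_(x in `[t, b]) f x.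
Proof.
move=> fi atx tb; rewrite -(Rintegral_itv_obnd_cbnd (r := t)).
  rewrite -(@Rintegral_itvB _ _ (BLeft a) (BRight b) t)//.
  by rewrite addrC subrK.
by apply: integrableS fi => // x /=; rewrite !in_itv/= => /andP[? ->]; rewrite andbT; lra.
Qed.

(** The primitive [(t - m) ^+ 2 / 2] takes equal values at the two endpoints. *)
Lemma Rintegral_itv_affine_mid (a b : R) : a < b ->
  \int[mu]_(t in `[a, b]) (t - (a + b) / 2) = 0.
Proof.
move=> ab; set m := (a + b) / 2.
have dF x : is_derive x (1 : R) (fun t => 2^-1 * (t - m) ^+ 2) (x - m).
  have d1 : is_derive x (1 : R) (fun t : R => t - m) 1.
    by rewrite -[X in is_derive _ _ _ X]subr0; exact: is_deriveB.
  have := is_deriveZ 2^-1 (is_deriveX 2 d1); rewrite exprfctE => h.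
  apply: is_derive_eq h _.
  transitivity (2^-1 * (2 * (x - m) ^+ 1 * 1) : R); first by [].
  by field.
have cF : continuous (fun t => 2^-1 * (t - m) ^+ 2).
  by move=> x; apply/differentiable_continuous/derivable1_diffP; have [] := dF x.
rewrite /Rintegral (@continuous_FTC2 _ _ (fun t => 2^-1 * (t - m) ^+ 2))//=.
- by rewrite /m; field.
- by apply: continuous_subspaceT => x; apply: cvgB; [exact: cvg_id|exact: cvg_cst].
- split; [|exact/cvg_at_right_filter/cF|exact/cvg_at_left_filter/cF].
  by move=> x _; have [] := dF x.
- by move=> x _; rewrite derive1E; have [_ ->] := dF x.
Qed.

Lemma trapezoid_local_error (f phi : R -> R) (a b c : R) : a < b ->
  {within `[a, b], continuous f} -> mu.-integrable `[a, b] (EFin \o phi) ->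
  (forall x y, a <= x -> x <= y -> y <= b ->
     f y - f x = \int[mu]_(t in `[x, y]) phi t) ->
  `|\int[mu]_(t in `[a, b]) f t - (b - a) / 2 * (f a + f b)| <=
  (b - a) / 2 * \int[mu]_(t in `[a, b]) `|phi t - c|.
Proof.
move=> ab cf iphi finc; set D := \int[mu]_(t in _) `|_|.
have icst (k x y : R) : mu.-integrable `[x, y] (EFin \o (fun=> k)).
  by apply: continuous_itv_integrable => t; exact: cvg_cst.
have iphiS x y : a <= x -> y <= b -> mu.-integrable `[x, y] (EFin \o phi).
  move=> ax yb; apply: integrableS iphi => // t /=; rewrite !in_itv/= => /andP[? ?].
  by apply/andP; split; lra.
have ipc x y : a <= x -> y <= b ->
    mu.-integrable `[x, y] (EFin \o (fun t => phi t - c)).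
  by move=> ax yb; have := integrableB _ (iphiS _ _ ax yb) (icst c x y); exact.
have incc x y : a <= x -> x <= y -> y <= b ->
    `|f y - f x - c * (y - x)| <= \int[mu]_(t in `[x, y]) `|phi t - c|.
  move=> ax xy yb; rewrite finc// -Rintegral_itv_cst// -RintegralB//; last first.
    exact: iphiS.
  by apply: le_normr_Rintegral => //; exact: ipc.
pose q t := f t - (f a + f b) / 2 - c * (t - (a + b) / 2).
(* Here [2 * q t] is the increment of [f x - c * x] over [[a, t]] minus that over [[t, b]], and the
   bounds for the two add up to [D]. *)
have qD t : a <= t -> t <= b -> `|q t| <= D / 2.
  move=> at_ tb; rewrite /D (@Rintegral_itv_split _ a b t)//; last first.
    by have := integrable_norm (ipc _ _ (lexx a) (lexx b)); exact.
  have := incc a t (lexx a) at_ tb; have := incc t b at_ tb (lexx b).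
  set D1 := Rintegral _ _ _; set D2 := Rintegral _ _ _.
  rewrite /q !ler_norml => /andP[? ?] /andP[? ?]; apply/andP; split; lra.
have ifab : mu.-integrable `[a, b] (EFin \o f) by exact: continuous_itv_integrable.
have il : mu.-integrable `[a, b] (EFin \o (fun t => t - (a + b) / 2)).
  apply: continuous_itv_integrable; apply: continuous_subspaceT => x.
  by apply: cvgB; [exact: cvg_id|exact: cvg_cst].
have icl : mu.-integrable `[a, b] (EFin \o (fun t => c * (t - (a + b) / 2))).
  by have := integrableZl _ c il; exact.
have ifm : mu.-integrable `[a, b] (EFin \o (fun t => f t - (f a + f b) / 2)).
  by have := integrableB _ ifab (icst ((f a + f b) / 2) a b); exact.
have iq : mu.-integrable `[a, b] (EFin \o q).
  by have := integrableB _ ifm icl; exact.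
have -> : \int[mu]_(t in `[a, b]) f t - (b - a) / 2 * (f a + f b) =
  \int[mu]_(t in `[a, b]) q t.
  have l0 : \int[mu]_(t in `[a, b]) (c * (t - (a + b) / 2)) = 0.
    by rewrite RintegralZl// Rintegral_itv_affine_mid// mulr0.
  rewrite /q RintegralB// l0 RintegralB//.
  by rewrite Rintegral_itv_cst ?ltW//; field.
apply: le_trans (le_normr_Rintegral _ iq) _ => //.
have -> : (b - a) / 2 * D = D / 2 * (b - a) by field.
apply: (@le_trans _ _ (\int[mu]_(x in `[a, b]) (D / 2))); last first.
  by rewrite Rintegral_itv_cst// ltW.
apply: le_Rintegral => //.
- by have := integrable_norm iq; exact.
- by move=> t /=; rewrite in_itv/= => /andP[? ?]; exact: qD.
Qed.

End LocalError.

(** * The scalar estimate *)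

Section ScalarBound.
Context {R : realType}.
Local Notation mu := (@lebesgue_measure R).

Lemma Rintegral_itv_sum (f : R -> R) (h : R) (k : nat) : 0 <= h ->
  mu.-integrable `[0, k%:R * h] (EFin \o f) ->
  \int[mu]_(t in `[0, k%:R * h]) f t =
  \sum_(i < k) \int[mu]_(t in `[i%:R * h, i.+1%:R * h]) f t.
Proof.
move=> h0; elim: k => [|k IH] fi.
  by rewrite big_ord0 mul0r set_itv1 Rintegral_set1.
have kh0 : 0 <= k%:R * h by rewrite mulr_ge0.
have khS : k%:R * h <= k.+1%:R * h by rewrite ler_wpM2r// ler_nat.
rewrite (@Rintegral_itv_split _ _ _ _ (k%:R * h))// big_ord_recr/= IH//.
by apply: integrableS fi => // x /=; rewrite !in_itv/= => /andP[-> ?]/=; lra.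
Qed.

(** Half-open cells tile without overlap; nonnegativity gives additivity even for infinite
    integrals. *)
Lemma ge0_integral_itv_sum (F : R -> \bar R) (h : R) (k : nat) : 0 <= h ->
  measurable_fun setT F -> (forall t, 0 <= F t)%E ->
  (\sum_(i < k) \int[mu]_(t in `](i%:R * h)%R, (i.+1%:R * h)%R]) F t =
   \int[mu]_(t in `]0%R, (k%:R * h)%R]) F t)%E.
Proof.
move=> h0 mF F0; elim: k => [|k IH].
  by rewrite big_ord0 mul0r set_itvoc0 integral_set0.
have kh0 : 0 <= k%:R * h by rewrite mulr_ge0.
have khS : k%:R * h <= k.+1%:R * h by rewrite ler_wpM2r// ler_nat.
rewrite big_ord_recr/= IH.
rewrite (@itv_bndbnd_setU _ _ (BRight 0) (BRight (k%:R * h)) (BRight (k.+1%:R * h))).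
- rewrite ge0_integral_setU//; first exact: measurable_funTS.
  apply/disj_setPS => x [/=]; rewrite !in_itv/= => /andP[_ ?] /andP[? _]; lra.
- by rewrite bnd_simp.
- by rewrite bnd_simp.
Qed.

Lemma powR_young (x e p : R) : 0 <= x -> 0 < e -> 1 <= p ->
  x <= e + e `^ (1 - p) * x `^ p.
Proof.
move=> x0 e0 p1; have [xe|ex] := leP x e.
  by apply: le_trans xe _; rewrite lerDl mulr_ge0// powR_ge0.
have x_gt0 : 0 < x by lra.
apply: (@le_trans _ _ (e `^ (1 - p) * x `^ p)); last by rewrite lerDr ltW.
have -> : x `^ p = x * x `^ (p - 1).
  rewrite -[x in x * _](@powRr1 _ x)// -powRD; first by congr (_ `^ _); ring.
  by rewrite (gt_eqF x_gt0) implybT.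
have -> : 1 - p = - (p - 1) by ring.
rewrite powRN mulrCA ler_pMr// mulrC ler_pdivlMr ?powR_gt0// mul1r.
by apply: ge0_ler_powR; rewrite ?nnegrE; lra.
Qed.

(** Integrates a pointwise bound of the kind given by [powR_young]; the right side is extended real,
    so [F] may have infinite integral. *)
Lemma Rintegral_le_affine (a b e B : R) (w : R -> R) (F : R -> \bar R) :
  a <= b -> 0 <= e -> 0 <= B -> (forall t, 0 <= w t) ->
  mu.-integrable `[a, b] (EFin \o w) ->
  measurable_fun `[a, b] F -> (forall t, 0 <= F t)%E ->
  (forall t, t \in `[a, b] -> (w t)%:E <= e%:E + B%:E * F t)%E ->
  ((\int[mu]_(t in `[a, b]) w t)%:E <=
   (e * (b - a))%:E + B%:E * \int[mu]_(t in `[a, b]) F t)%E.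
Proof.
move=> ab e0 B0 w0 wi mF F0 wF.
rewrite /Rintegral fineK; last exact: integrable_fin_num.
apply: (@le_trans _ _ (\int[mu]_(t in `[a, b]) (e%:E + B%:E * F t))%E).
  by apply: ge0_le_integral_nonmeasurable => t tab; rewrite ?lee_fin//; exact: wF.
have BF0 t : (0 <= B%:E * F t)%E by rewrite mule_ge0.
rewrite ge0_integralD//; last exact: measurable_funeM.
rewrite ge0_integralZl// (integral_cst _ _ e%:E)//= lebesgue_measure_itv/= lte_fin.
case: ltgtP ab => [//|//|-> _]; rewrite ?subrr ?mulr0 ?mule0//.
Qed.

Lemma trapezoid_local_error_Lp (f phi : R -> R) (a b e p : R) : a < b ->
  0 < e -> 1 <= p ->
  {within `[a, b], continuous f} -> mu.-integrable setT (EFin \o phi) ->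
  (forall x y, a <= x -> x <= y -> y <= b ->
     f y - f x = \int[mu]_(t in `[x, y]) phi t) ->
  (`|\int[mu]_(t in `[a, b]) f t - (b - a) / 2 * (f a + f b)|%:E <=
   (2^-1)%:E * ((e * (b - a) ^+ 2)%:E +
     (e `^ (1 - p) * (b - a))%:E *
      \int[mu]_(t in `]a, b]) (`|phi t| `^ p)%:E))%E.
Proof.
move=> ab e0 p1 cf iphi finc.
have iphiab : mu.-integrable `[a, b] (EFin \o phi) by exact: integrableS iphi.
have mphi : measurable_fun setT phi.
  by apply/measurable_EFinP; exact: measurable_int iphi.
have mF : measurable_fun setT (fun t => (`|phi t| `^ p)%:E).
  apply/measurable_EFinP; apply: (measurableT_comp (measurable_powR _)).
  exact: measurableT_comp.
rewrite (integral_itv_obnd_cbnd (r := a)); last exact: measurable_funTS.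
have -> : (e * (b - a) ^+ 2)%:E = ((b - a)%:E * (e * (b - a))%:E)%E.
  by rewrite -EFinM; congr EFin; ring.
rewrite (mulrC (e `^ (1 - p))) (EFinM (b - a) (e `^ (1 - p))) -muleA -ge0_muleDr; last 2 first.
- by rewrite lee_fin mulr_ge0; lra.
- by rewrite mule_ge0 ?lee_fin ?powR_ge0//; apply: integral_ge0 => t _; rewrite lee_fin powR_ge0.
rewrite muleA -EFinM (mulrC 2^-1).
(* The local estimate is used with slope [c = 0]. *)
apply: (@le_trans _ _ ((b - a) / 2 * \int[mu]_(t in `[a, b]) `|phi t - 0|)%:E).
  by rewrite lee_fin; exact: trapezoid_local_error.
under eq_Rintegral do rewrite subr0.
rewrite EFinM lee_pmul2l//; last by rewrite lte_fin; lra.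
apply: Rintegral_le_affine => //.
- exact: ltW.
- exact: ltW.
- exact: powR_ge0.
- by have := integrable_norm iphiab; exact.
- exact: measurable_funTS.
- by move=> t _; rewrite -EFinM -EFinD lee_fin powR_young.
Qed.

(* For [p != 0] the value on the diagonal is [0], even though the denominator
   vanishes there. *)
Definition slobodeckij_kernel (p beta : R) (phi : R -> R) (z : R * R) : R :=
  `|phi z.1 - phi z.2| `^ p / `|z.1 - z.2| `^ beta.

Lemma slobodeckij_kernel_ge0 p beta phi z : 0 <= slobodeckij_kernel p beta phi z.
Proof. by rewrite /slobodeckij_kernel divr_ge0 ?powR_ge0. Qed.

Lemma measurable_slobodeckij_kernel p beta phi : measurable_fun setT phi ->
  measurable_fun setT (slobodeckij_kernel p beta phi).
Proof.
move=> mphi.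
(* A negative exponent replaces the division, leaving a product of measurable powers. *)
have -> : slobodeckij_kernel p beta phi =
    (fun z => `|phi z.1 - phi z.2| `^ p * `|z.1 - z.2| `^ (- beta)).
  by apply/funext => z; rewrite powRN.
apply: measurable_funM.
  apply: (measurableT_comp (measurable_powR _)); apply: measurableT_comp => //.
  by apply: measurable_funB; exact: measurableT_comp.
apply: (measurableT_comp (measurable_powR _)); apply: measurableT_comp => //.
exact: measurable_funB.
Qed.

(** Tonelli applies to a kernel on the whole plane, so the restriction to [D] is encoded by an
    indicator in the second variable. *)
Lemma measurable_slobodeckij_section p beta phi (D : set R) : measurable D ->
  measurable_fun setT phi ->
  measurable_fun setT
    (fun t => \int[mu]_(u in D) (slobodeckij_kernel p beta phi (t, u))%:E)%E.
Proof.
move=> mD mphi.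
pose K (z : R * R) : \bar R := (slobodeckij_kernel p beta phi z * \1_D z.2)%:E.
have mK : measurable_fun setT K.
  apply/measurable_EFinP; apply: measurable_funM.
    exact: measurable_slobodeckij_kernel.
  by apply: (measurableT_comp (measurable_indic mD)).
have K0 z : (0 <= K z)%E by rewrite lee_fin mulr_ge0// slobodeckij_kernel_ge0.
have := measurable_fun_fubini_tonelli_F (m2 := mu) K mK K0.
congr (measurable_fun _ _); apply/funext => t.
rewrite /fubini_F [RHS]integral_mkcond; apply: eq_integral => u _.
rewrite /K patchE/= indicE.
by case: (u \in D); rewrite ?mulr1 ?mulr0.
Qed.

Lemma trapezoid_local_error_slobodeckij (f phi : R -> R) (D : set R) (a b e p beta : R) :
  a < b -> 0 < e -> 1 <= p -> 0 <= beta -> measurable D -> `]a, b[ `<=` D ->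
  {within `[a, b], continuous f} -> mu.-integrable setT (EFin \o phi) ->
  (forall x y, a <= x -> x <= y -> y <= b ->
     f y - f x = \int[mu]_(t in `[x, y]) phi t) ->
  (`|\int[mu]_(t in `[a, b]) f t - (b - a) / 2 * (f a + f b)|%:E <=
   (2^-1)%:E * ((e * (b - a) ^+ 2)%:E +
     (e `^ (1 - p) * (b - a) `^ beta)%:E *
      \int[mu]_(t in `]a, b]) \int[mu]_(u in D) (slobodeckij_kernel p beta phi (t, u))%:E))%E.
Proof.
move=> ab e0 p1 beta0 mD abD cf iphi finc; set err := `|_|.
have iphiab : mu.-integrable `[a, b] (EFin \o phi) by exact: integrableS iphi.
have mphi : measurable_fun setT phi.
  by apply/measurable_EFinP; exact: measurable_int iphi.
set h := b - a; have h0 : 0 < h by rewrite subr_gt0.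
set B := e `^ (1 - p) * h `^ beta.
have B0 : 0 <= B by rewrite mulr_ge0// powR_ge0.
pose Psi t := (\int[mu]_(u in D) (slobodeckij_kernel p beta phi (t, u))%:E)%E.
have mPsi : measurable_fun setT Psi by exact: measurable_slobodeckij_section.
have Psi0 t : (0 <= Psi t)%E.
  by apply: integral_ge0 => u _; rewrite lee_fin slobodeckij_kernel_ge0.
have pt t : t \in `[a, b] ->
    (err%:E <= (h / 2)%:E * ((e * h)%:E + B%:E * Psi t))%E.
  rewrite in_itv/= => /andP[at_ tb].
  apply: (@le_trans _ _ (h / 2 * \int[mu]_(u in `[a, b]) `|phi u - phi t|)%:E).
    by rewrite lee_fin; exact: trapezoid_local_error.
  rewrite EFinM lee_pmul2l//; last by rewrite lte_fin divr_gt0.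
  have mker : measurable_fun setT (fun u => (slobodeckij_kernel p beta phi (t, u))%:E).
    apply/measurable_EFinP.
    apply: (measurableT_comp (measurable_slobodeckij_kernel p beta phi mphi)).
    exact: measurable_pair1.
  apply: (@le_trans _ _ ((e * h)%:E + B%:E *
      \int[mu]_(u in `[a, b]) (slobodeckij_kernel p beta phi (t, u))%:E)%E).
    apply: Rintegral_le_affine => //.
    - exact: ltW.
    - exact: ltW.
    - have ic : mu.-integrable `[a, b] (EFin \o (fun=> phi t)).
        by apply: continuous_itv_integrable => x; exact: cvg_cst.
      by have := integrable_norm (integrableB _ iphiab ic); exact.
    - exact: measurable_funTS.
    - by move=> u; rewrite lee_fin slobodeckij_kernel_ge0.
    - move=> u; rewrite in_itv/= => /andP[au ub]; rewrite -EFinM -EFinD lee_fin.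
      apply: (le_trans (powR_young _ e p (normr_ge0 _) e0 p1)).
      rewrite lerD2l /B -mulrA ler_wpM2l ?powR_ge0//.
      rewrite /slobodeckij_kernel/= (distrC (phi t)) mulrCA.
      (* On the diagonal the numerator already vanishes; elsewhere [h]^ beta / |t - u| [^ beta] is
         at least [1]. *)
      have [->|ut] := eqVneq u t.
        by rewrite !subrr normr0 powR0 ?mul0r//; lra.
      rewrite ler_peMr ?powR_ge0// ler_pdivlMr ?powR_gt0 ?normr_gt0 ?subr_eq0 1?eq_sym//.
      rewrite mul1r; apply: ge0_ler_powR; rewrite ?nnegrE//; first exact: ltW.
      by rewrite ler_norml /h; apply/andP; split; lra.
  rewrite leeD2l// lee_wpmul2l ?lee_fin//.
  (* Only the open cell is known to lie in [D], so the endpoints are dropped before enlarging the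
     domain. *)
  rewrite integral_itv_bndoo; last exact: measurable_funTS.
  apply: ge0_subset_integral => //; first exact: measurable_funTS.
  by move=> u _; rewrite lee_fin slobodeckij_kernel_ge0.
(* The average over [t]: [h] times the error is the integral of a constant over the cell, bounded
   pointwise by [pt]. *)
rewrite -(@lee_pmul2l _ h%:E)//.
have -> : (h%:E * err%:E = \int[mu]_(t in `]a, b]) (cst err%:E) t)%E.
  by rewrite integral_cst//= lebesgue_measure_itv/= lte_fin ab muleC.
apply: (@le_trans _ _ (\int[mu]_(t in `]a, b]) ((h / 2)%:E * ((e * h)%:E + B%:E * Psi t)))%E).
  apply: ge0_le_integral_nonmeasurable => t; first by rewrite lee_fin /err.
  by move=> tab; apply: pt; apply: subset_itv_oc_cc.
have BPsi0 t : (0 <= B%:E * Psi t)%E by rewrite mule_ge0// lee_fin.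
have eh0 : (0 <= (e * h)%:E)%E by rewrite lee_fin mulr_ge0// ltW.
have mBPsi : measurable_fun setT (fun t => B%:E * Psi t)%E by exact: measurable_funeM.
rewrite ge0_integralZl//; last 3 first.
- by apply: emeasurable_funD => //; exact: measurable_funTS.
- by move=> t _; rewrite adde_ge0.
- by rewrite lee_fin divr_ge0// ltW.
rewrite ge0_integralD//; last exact: measurable_funTS.
rewrite ge0_integralZl//; last exact: measurable_funTS.
rewrite (integral_cst _ _ (e * h)%:E)//= lebesgue_measure_itv/= lte_fin ab.
by rewrite -EFinB -EFinM muleA -EFinM -/h expr2 mulrA.
Qed.

Lemma trapezoid_errorE (f : R -> R) (T h : R) (N : nat) : 0 <= h -> N%:R * h = T ->
  {within `[0, T], continuous f} ->
  \int[mu]_(t in `[0, T]) f t - h / 2 * \sum_(i < N) (f (i%:R * h) + f (i.+1%:R * h)) =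
  \sum_(i < N) (\int[mu]_(t in `[i%:R * h, i.+1%:R * h]) f t -
    (i.+1%:R * h - i%:R * h) / 2 * (f (i%:R * h) + f (i.+1%:R * h))).
Proof.
move=> h0 <- cf; rewrite Rintegral_itv_sum//; last exact: continuous_itv_integrable.
rewrite mulr_sumr -sumrB; apply: eq_bigr => i _.
by rewrite -mulrBl -natr1 [_ + 1]addrC addrK mul1r.
Qed.

(** Summing the cells multiplies the constant part by [N], while the cell integrals of [F] join into
    one over []0, T[]. *)
Lemma trapezoid_error_sum (f : R -> R) (F : R -> \bar R) (T h A B : R) (N : nat) :
  0 <= h -> N%:R * h = T -> 0 <= A -> 0 <= B ->
  {within `[0, T], continuous f} -> measurable_fun setT F -> (forall t, 0 <= F t)%E ->
  (forall i, (i < N)%N ->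
    (`|\int[mu]_(t in `[i%:R * h, i.+1%:R * h]) f t -
     (i.+1%:R * h - i%:R * h) / 2 * (f (i%:R * h) + f (i.+1%:R * h))|%:E <=
     (2^-1)%:E * (A%:E +
       B%:E * \int[mu]_(t in `](i%:R * h)%R, (i.+1%:R * h)%R]) F t))%E) ->
  (`|\int[mu]_(t in `[0, T]) f t -
     h / 2 * \sum_(i < N) (f (i%:R * h) + f (i.+1%:R * h))|%:E <=
   (2^-1)%:E * ((N%:R * A)%:E + B%:E * \int[mu]_(t in `]0%R, T[) F t))%E.
Proof.
move=> h0 NhT A0 B0 cf mF F0 H.
rewrite (trapezoid_errorE _ _ _ _ h0 NhT)//.
apply: (@le_trans _ _ (\sum_(i < N) (2^-1)%:E * (A%:E +
       B%:E * \int[mu]_(t in `](i%:R * h)%R, (i.+1%:R * h)%R]) F t))%E).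
  apply: (@le_trans _ _ (\sum_(i < N) `|\int[mu]_(t in `[i%:R * h, i.+1%:R * h]) f t -
     (i.+1%:R * h - i%:R * h) / 2 * (f (i%:R * h) + f (i.+1%:R * h))|%:E)%E).
    by rewrite sumEFin lee_fin; exact: ler_norm_sum.
  by apply: lee_sum => i _; exact: H.
have X0 i : (0 <= \int[mu]_(t in `](i%:R * h)%R, (i.+1%:R * h)%R]) F t)%E.
  by apply: integral_ge0 => t _.
have BX0 i : (0 <= B%:E * \int[mu]_(t in `](i%:R * h)%R, (i.+1%:R * h)%R]) F t)%E.
  by rewrite mule_ge0 ?lee_fin.
rewrite -ge0_sume_distrr; last by move=> i _; rewrite adde_ge0 ?lee_fin.
rewrite big_split/= sumEFin sumr_const card_ord -(mulr_natl A) -ge0_sume_distrr//.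
rewrite ge0_integral_itv_sum// NhT integral_itv_bndo_bndc//.
exact: measurable_funTS.
Qed.

(** Allows a strictly positive [V] in place of the seminorm bound [W], which may be zero although
    [e] must be positive. *)
Lemma le_mul_of_gt (x K W : R) : 0 < K -> (forall V, W < V -> x <= K * V) -> x <= K * W.
Proof.
move=> K0 H; apply/ler_addgt0Pr => e e0.
have -> : K * W + e = K * (W + e / K) by field; rewrite gt_eqF.
by apply: H; rewrite ltrDl divr_gt0.
Qed.

(* With this [e] both terms coming from [powR_young] have the same size. *)
Lemma powR_balance (T h p s V : R) : 0 < T -> 0 < h -> 0 < V -> p != 0 ->
  let e := h `^ (s - 1) * T `^ (- p^-1) * V in
  T * h * e = T `^ (1 - p^-1) * h `^ s * V /\
  e `^ (1 - p) * h `^ (1 + (s - 1) * p) * V `^ p = T `^ (1 - p^-1) * h `^ s * V.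
Proof.
move=> T0 h0 V0 p0 e.
have D (x a b : R) : 0 < x -> x `^ (a + b) = x `^ a * x `^ b.
  by move=> x0; rewrite powRD// (gt_eqF x0) implybT.
split.
  rewrite /e (D T) // (_ : h `^ s = h * h `^ (s - 1)).
    by rewrite powRr1 ?ltW//; ring.
  by rewrite -{2}(@powRr1 _ h) ?ltW// -D//; congr (_ `^ _); ring.
rewrite /e !powRM ?mulr_ge0 ?powR_ge0 ?ltW// -!powRrM.
have -> : - p^-1 * (1 - p) = 1 - p^-1 by field.
(* The exponents of [h] add up to [s]; below, those of [V] add up to [1]. *)
have -> : h `^ s = h `^ ((s - 1) * (1 - p)) * h `^ (1 + (s - 1) * p).
  by rewrite -D//; congr (_ `^ _); ring.
have {3}-> : V = V `^ (1 - p) * V `^ p.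
  by rewrite -D// -[LHS](@powRr1 _ V) ?ltW//; congr (_ `^ _); ring.
ring.
Qed.

(** By [powR_balance] both parts of the summed error are at most the target bound, and the factor
    [2^-1] from the cells absorbs their number. *)
Lemma scalar_trapezoid_error (T p s W : R) (N : nat) (f phi : R -> R) :
  0 < T -> (0 < N)%N -> 1 <= p -> 1 <= s ->
  {within `[0, T], continuous f} -> mu.-integrable setT (EFin \o phi) ->
  (forall x y, 0 <= x -> x <= y -> y <= T ->
     f y - f x = \int[mu]_(t in `[x, y]) phi t) ->
  0 <= W ->
  ((if (s == 1)%R then \int[mu]_(t in `]0%R, T[) (`|phi t| `^ p)%:E
    else \int[mu]_(t in `]0%R, T[) \int[mu]_(u in `]0%R, T[)
       (slobodeckij_kernel p (1 + (s - 1) * p) phi (t, u))%:E) <= (W `^ p)%:E)%E ->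
  `|\int[mu]_(t in `[0, T]) f t -
     T / N%:R / 2 * \sum_(i < N) (f (i%:R * (T / N%:R)) + f (i.+1%:R * (T / N%:R)))|
  <= T `^ (1 - p^-1) * (T / N%:R) `^ s * W.
Proof.
move=> T0 N0 p1 s1 cf iphi finc W0 HS.
have NR0 : 0 < N%:R :> R by rewrite ltr0n.
set h := T / N%:R; have h0 : 0 < h by rewrite divr_gt0.
have NhT : N%:R * h = T by rewrite /h mulrC divfK// gt_eqF.
apply: le_mul_of_gt => [|V WV]; first by rewrite mulr_gt0 ?powR_gt0.
have V0 : 0 < V by exact: le_lt_trans WV.
have p0 : p != 0 by rewrite gt_eqF//; lra.
have [bal1 bal2] := powR_balance _ _ p s _ T0 h0 V0 p0.
set e := _ * _ * V in bal1 bal2.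
have e0 : 0 < e by rewrite !mulr_gt0 ?powR_gt0.
set beta := 1 + (s - 1) * p in HS bal2.
have beta0 : 0 <= beta by rewrite addr_ge0// mulr_ge0; lra.
pose F t : \bar R := if s == 1 then (`|phi t| `^ p)%:E
  else (\int[mu]_(u in `]0%R, T[) (slobodeckij_kernel p beta phi (t, u))%:E)%E.
have mphi : measurable_fun setT phi.
  by apply/measurable_EFinP; exact: measurable_int iphi.
have mF : measurable_fun setT F.
  rewrite /F; case: (s == 1); last exact: measurable_slobodeckij_section.
  apply/measurable_EFinP; apply: (measurableT_comp (measurable_powR _)).
  exact: measurableT_comp.
have F0 t : (0 <= F t)%E.
  rewrite /F; case: ifP => _; first by rewrite lee_fin powR_ge0.
  by apply: integral_ge0 => u _; rewrite lee_fin slobodeckij_kernel_ge0.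
have FV : (\int[mu]_(t in `]0%R, T[) F t <= (V `^ p)%:E)%E.
  apply: (@le_trans _ _ (W `^ p)%:E).
    by move: HS; rewrite /F; case: (s == 1).
  rewrite lee_fin; apply: ge0_ler_powR; rewrite ?nnegrE; lra.
have hS (i : nat) : i.+1%:R * h - i%:R * h = h.
  by rewrite -mulrBl -natr1 [_ + 1]addrC addrK mul1r.
have loc (i : nat) : (i < N)%N ->
    (`|\int[mu]_(t in `[i%:R * h, i.+1%:R * h]) f t -
     (i.+1%:R * h - i%:R * h) / 2 * (f (i%:R * h) + f (i.+1%:R * h))|%:E <=
     (2^-1)%:E * ((e * h ^+ 2)%:E + (e `^ (1 - p) * h `^ beta)%:E *
       \int[mu]_(t in `](i%:R * h)%R, (i.+1%:R * h)%R]) F t))%E.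
  move=> iN.
  have ih0 : 0 <= i%:R * h by rewrite mulr_ge0// ltW.
  have ihS : i%:R * h < i.+1%:R * h by rewrite ltr_pM2r// ltr_nat.
  have iST : i.+1%:R * h <= T by rewrite -NhT ler_pM2r// ler_nat.
  have cfi : {within `[i%:R * h, i.+1%:R * h], continuous f}.
    apply: continuous_subspaceW cf => x /=; rewrite !in_itv/= => /andP[? ?].
    by apply/andP; split; lra.
  have finci x y : i%:R * h <= x -> x <= y -> y <= i.+1%:R * h ->
      f y - f x = \int[mu]_(t in `[x, y]) phi t.
    by move=> ? ? ?; apply: finc; lra.
  rewrite /F; case: (boolP (s == 1)) => s1E.
    have := trapezoid_local_error_Lp _ _ _ _ _ _ ihS e0 p1 cfi iphi finci.
    (* For [s = 1] the exponent [beta] is [1], so both cases share the same coefficient. *)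
    by rewrite !hS /beta (eqP s1E) subrr mul0r addr0 powRr1// ltW.
  have iD : `]i%:R * h, i.+1%:R * h[ `<=` `]0, T[.
    move=> x /=; rewrite !in_itv/= => /andP[? ?].
    by apply/andP; split; lra.
  have := trapezoid_local_error_slobodeckij _ _ `]0, T[ _ _ _ _ _ ihS e0 p1 beta0
    (measurable_itv _) iD cfi iphi finci.
  by rewrite !hS.
have B0 : 0 <= e `^ (1 - p) * h `^ beta by rewrite mulr_ge0 ?powR_ge0.
have A0 : 0 <= e * h ^+ 2 by rewrite mulr_ge0 ?exprn_ge0 ?ltW.
have := trapezoid_error_sum _ _ _ _ _ _ _ (ltW h0) NhT A0 B0 cf mF F0 loc.
rewrite -lee_fin => /le_trans; apply.
apply: (@le_trans _ _ ((2^-1)%:E * ((N%:R * (e * h ^+ 2))%:E +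
  (e `^ (1 - p) * h `^ beta)%:E * (V `^ p)%:E))%E).
  rewrite lee_pmul2l// leeD2l// lee_wpmul2l// lee_fin//.
rewrite -(EFinM _ (V `^ p)) -EFinD -EFinM lee_fin bal2.
have -> : N%:R * (e * h ^+ 2) = T * h * e by rewrite -NhT; ring.
rewrite bal1; lra.
Qed.

End ScalarBound.

(** * From scalars to vectors *)

Section VectorReduction.
Context {R : realType}.
Local Notation mu := (@lebesgue_measure R).

Lemma enorm_ge0 (d : nat) (w : 'rV[R]_d) : 0 <= enorm w.
Proof. exact: sqrtr_ge0. Qed.

Lemma sqr_enorm (d : nat) (w : 'rV[R]_d) : enorm w ^+ 2 = \sum_(i < d) (w ord0 i) ^+ 2.
Proof. by rewrite sqr_sqrtr// sumr_ge0// => i _; exact: sqr_ge0. Qed.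

(** Cauchy-Schwarz for unit [v]: the gap between the squares is the squared length of [w - s *: v],
    the part of [w] orthogonal to [v]. *)
Lemma unit_dot_le_enorm (d : nat) (v w : 'rV[R]_d) : enorm v = 1 ->
  `|\sum_(i < d) v ord0 i * w ord0 i| <= enorm w.
Proof.
move=> v1; set s := \sum_(i < d) _.
rewrite -ler_sqr ?nnegrE ?enorm_ge0// real_normK ?num_real// sqr_enorm.
rewrite -subr_ge0.
suff -> : \sum_(i < d) (w ord0 i) ^+ 2 - s ^+ 2 =
    \sum_(i < d) (w ord0 i - s * v ord0 i) ^+ 2.
  by rewrite sumr_ge0// => i _; exact: sqr_ge0.
under [RHS]eq_bigr => i _.
  rewrite (_ : _ ^+ 2 = (w ord0 i) ^+ 2 +
    ((- 2 * s) * (v ord0 i * w ord0 i) + s ^+ 2 * (v ord0 i) ^+ 2)); last by ring.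
  over.
rewrite !big_split/= -!mulr_sumr -/s -!sqr_enorm v1; ring.
Qed.

Lemma enorm_dual (d : nat) (w : 'rV[R]_d) : 0 < enorm w ->
  exists2 v : 'rV[R]_d, enorm v = 1 & \sum_(i < d) v ord0 i * w ord0 i = enorm w.
Proof.
move=> w0; have vE i : ((enorm w)^-1 *: w) ord0 i = (enorm w)^-1 * w ord0 i.
  by rewrite mxE.
exists ((enorm w)^-1 *: w).
  rewrite {1}/enorm; under eq_bigr do rewrite vE exprMn.
  by rewrite -mulr_sumr -sqr_enorm -exprMn mulVf ?gt_eqF// expr1n sqrtr1.
under eq_bigr do rewrite vE -mulrA -expr2.
by rewrite -mulr_sumr -sqr_enorm expr2 mulrA mulVf ?mul1r// gt_eqF.
Qed.

Lemma integrable_lincomb (d : nat) (v : 'I_d -> R) (F : 'I_d -> R -> R) (A : set R) :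
  measurable A -> (forall i, mu.-integrable A (EFin \o F i)) ->
  mu.-integrable A (EFin \o (fun t => \sum_(i < d) v i * F i t)).
Proof.
move=> mA iF.
have -> : EFin \o (fun t => \sum_(i < d) v i * F i t) =
    (fun t => \sum_(i < d) ((v i)%:E * (F i t)%:E)%E).
  by apply/funext => t /=; rewrite -sumEFin.
apply: integrable_sum => // i _; by have := integrableZl _ (v i) (iF i); exact.
Qed.

Lemma Rintegral_lincomb (d : nat) (v : 'I_d -> R) (F : 'I_d -> R -> R) (A : set R) :
  measurable A -> (forall i, mu.-integrable A (EFin \o F i)) ->
  \int[mu]_(t in A) (\sum_(i < d) v i * F i t) = \sum_(i < d) v i * \int[mu]_(t in A) F i t.
Proof.
move=> mA; elim: d v F => [|d IH] v F iF.
  under eq_Rintegral do rewrite big_ord0.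
  by rewrite big_ord0 /Rintegral integral0.
under eq_Rintegral do rewrite big_ord_recl.
rewrite RintegralD//; last 2 first.
- by have := integrableZl _ (v ord0) (iF ord0); exact.
- by apply: integrable_lincomb.
by rewrite big_ord_recl RintegralZl// IH.
Qed.

Lemma coord_continuous_within (d : nat) (i : 'I_d) (g : R -> 'rV[R]_d) (A : set R) :
  {within A, continuous g} -> {within A, continuous (fun t => g t ord0 i)}.
Proof.
move=> cg x.
apply: (@continuous_comp (subspace A) 'rV[R]_d R g (fun w => w ord0 i) x).
  exact: cg.
exact: coord_continuous.
Qed.

Lemma lincomb_continuous_within (d : nat) (v : 'I_d -> R) (F : 'I_d -> R -> R) (A : set R) :
  (forall i, {within A, continuous (F i)}) ->
  {within A, continuous (fun t => \sum_(i < d) v i * F i t)}.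
Proof.
move=> cF x; apply: cvg_big => [|i _]; first exact: add_continuous.
by apply: cvgM; [exact: cvg_cst|exact: cF].
Qed.

(** Finiteness makes [fine] lossless and the power [p] undoes the root; the remaining summands are
    nonnegative. *)
Lemma seminorm_pow_le_W_norm (d : nat) (T s p : R) (g gd : R -> 'rV[R]_d) :
  p != 0 -> (W_norm_pow T s p g gd < +oo)%E ->
  ((if (s == 1)%R then Lp_pow T p gd else slobodeckij_pow T s p gd) <=
    (W_norm T s p g gd `^ p)%:E)%E.
Proof.
move=> p0 Woo.
have L0 (f : R -> 'rV[R]_d) : (0 <= Lp_pow T p f)%E.
  by apply: integral_ge0 => t _; rewrite lee_fin powR_ge0.
have S0 : (0 <= slobodeckij_pow T s p gd)%E.
  apply: integral_ge0 => t _; apply: integral_ge0 => u _.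
  by rewrite lee_fin divr_ge0 ?powR_ge0.
have W0 : (0 <= W_norm_pow T s p g gd)%E.
  by rewrite /W_norm_pow; case: ifP => _; do ?[apply: adde_ge0 => //].
have Wfin : W_norm_pow T s p g gd \is a fin_num by rewrite ge0_fin_numE.
rewrite /W_norm -powRrM mulVf// powRr1 ?fine_ge0// fineK// /W_norm_pow.
by case: ifP => _; rewrite leeDr// adde_ge0.
Qed.

End VectorReduction.

Theorem theorem3p1 (R : realType) (p : R) (hp : 2 <= p) :
  exists C : R, forall (T sigma : R) (d : nat) (g gd : R -> 'rV[R]_d),
    0 < T -> 1 <= sigma -> sigma < 2 ->
    {within `[0, T], continuous g} ->
    in_W T sigma p g gd ->
    forall N : nat, (0 < N)%N ->
      enorm (vintegral 0 T g - trapezoid T N g)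
      <= C * T `^ (1 - p^-1) * (T / N%:R) `^ sigma * W_norm T sigma p g gd.
Proof.
exists 1 => T sigma d g gd T0 s1 _ cg [_ [wd Woo]] N N0; rewrite mul1r.
set E := _ - _; set W := W_norm _ _ _ _ _.
have W0 : 0 <= W by exact: powR_ge0.
(* A zero error has no direction to pair with and is settled at once. *)
have := enorm_ge0 _ E; rewrite le_eqVlt => /predU1P[<-|r0].
  by rewrite !mulr_ge0 ?powR_ge0.
have [v v1 vE] := enorm_dual _ _ r0.
pose G t := \sum_(i < d) v ord0 i * g t ord0 i.
(* Extension by zero makes [phi] integrable on the whole line, as the scalar estimate requires. *)
pose dG i := (fun t => gd t ord0 i) \_ `]0, T[.
pose phi t := \sum_(i < d) v ord0 i * dG i t.
have idG i : (@lebesgue_measure R).-integrable setT (EFin \o dG i).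
  by apply: integrable_patch => //; have [_ []] := wd i.
have cgi i : {within `[0, T], continuous (fun t => g t ord0 i)}.
  exact: coord_continuous_within.
have phiE t : t \in `]0, T[ -> phi t = \sum_(i < d) v ord0 i * gd t ord0 i.
  by move=> tT; apply: eq_bigr => i _; rewrite /dG patchE mem_set.
have phi_le t : t \in `]0, T[ -> `|phi t| `^ p <= enorm (gd t) `^ p.
  move=> tT; apply: ge0_ler_powR; rewrite ?nnegrE ?enorm_ge0//; first lra.
  by rewrite phiE//; exact: unit_dot_le_enorm.
have phiB_le t u : t \in `]0, T[ -> u \in `]0, T[ ->
    `|phi t - phi u| `^ p <= enorm (gd t - gd u) `^ p.
  move=> tT uT; apply: ge0_ler_powR; rewrite ?nnegrE ?enorm_ge0//; first lra.
  suff -> : phi t - phi u = \sum_(i < d) v ord0 i * (gd t - gd u) ord0 i.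
    exact: unit_dot_le_enorm.
  rewrite !phiE// -sumrB; apply: eq_bigr => i _; rewrite -mulrBr.
  by congr (_ * _); rewrite !mxE.
(* Pairing with [v] commutes with integral and quadrature, so the length of the error is exactly the
   scalar error of [G]. *)
have -> : enorm E = \int[@lebesgue_measure R]_(t in `[0, T]) G t -
    T / N%:R / 2 * \sum_(i < N) (G (i%:R * (T / N%:R)) + G (i.+1%:R * (T / N%:R))).
  rewrite -vE.
  rewrite Rintegral_lincomb//; last by move=> i; exact: continuous_itv_integrable.
  have GD a b : G a + G b = \sum_(i < d) v ord0 i * (g a + g b) ord0 i.
    by rewrite -big_split/=; apply: eq_bigr => i _; rewrite -mulrDr [in RHS]mxE.
  under [X in _ = _ - _ * X]eq_bigr do rewrite GD.
  rewrite exchange_big/= mulr_sumr -sumrB; apply: eq_bigr => i _.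
  rewrite /E /vintegral /trapezoid !mxE summxE mulrBr; congr (_ - _).
  by rewrite mulrCA mulr_sumr; congr (_ * _).
apply: le_trans (ler_norm _) _; apply: (scalar_trapezoid_error T p sigma W N G phi) => //.
- lra.
- exact: lincomb_continuous_within.
- exact: integrable_lincomb.
- move=> x y x0 xy yT.
  have dGi : forall i, (@lebesgue_measure R).-integrable `[x, y] (EFin \o dG i).
    by move=> i; exact: integrableS (idG i).
  rewrite Rintegral_lincomb// -sumrB; apply: eq_bigr => i _.
  have [_ [igd wk]] := wd i.
  by rewrite -mulrBr (weak_derivative_increment _ _ _ T0 (cgi i) igd wk).
- have p0 : p != 0 by rewrite gt_eqF//; lra.
  (* Pairing with a unit vector does not increase lengths, so the seminorm of [phi] is at most that
     of [gd], with no factor depending on [d]. *)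
  apply: le_trans (seminorm_pow_le_W_norm _ _ _ _ _ _ p0 Woo).
  case: (sigma == 1); apply: ge0_le_integral_nonmeasurable => t tT.
  + by rewrite lee_fin powR_ge0.
  + by rewrite lee_fin phi_le.
  + by apply: integral_ge0 => u _; rewrite lee_fin slobodeckij_kernel_ge0.
  + apply: ge0_le_integral_nonmeasurable => u uT.
      by rewrite lee_fin slobodeckij_kernel_ge0.
    by rewrite lee_fin ler_wpM2r ?invr_ge0 ?powR_ge0// phiB_le.
Qed.
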